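(* Let $d\ge 1$ and let $\mathcal{B}_d^+$ be the set of all boxes $\prod_{i=1}^d[a_i,b_i]\subseteq\mathbb{R}^d$ with $a_i\le b_i$ nonnegative integers. The $\mathbb{C}$-algebra homomorphism $\phi:\mathbb{C}[x_1,\dots,x_d,y_1,\dots,y_d]\to M(\mathcal{B}_d^+)$ given by $\phi(x_i)=[\{\tilde e_i\}]$ and $\phi(y_i)=[\pi_i([0,1]^d)]$ is surjective with kernel $\ker(\phi)=((y_1-1)(y_1-x_1),\dots,(y_d-1)(y_d-x_d))$, and so $$M(\mathcal{B}_d^+)\cong \mathbb{C}[x_1,\dots,x_d,y_1,\dots,y_d]/((y_1-1)(y_1-x_1),\dots,(y_d-1)(y_d-x_d)).$$ In particular $M(\mathcal{B}_d^+)\cong\bigotimes_{i=1}^d M(\mathcal{B}_1^+)=\bigotimes_{i=1}^d M(\{1\},[0,1])$, where the tensor product is taken over $\mathbb{C}$.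
   Context: For $S\subseteq W=\mathbb{R}^d$, $[S]:W\to\mathbb{C}$ denotes its indicator function. Let $M(\mathcal{P}(W))$ be the complex vector space of functions on $W$ spanned by the indicator functions of closed convex polyhedra; it is a commutative $\mathbb{C}$-algebra with the well-defined bilinear product determined by $[A]\cdot[B]=[A+B]$ (Minkowski sum) for nonempty closed convex polyhedra $A,B$, with unit $[\{0\}]$. For a set $\mathcal{D}$ of closed convex polyhedra, the Minkowski ring $M(\mathcal{D})$ is the unital $\mathbb{C}$-subalgebra generated by all $[P]$, $P\in\mathcal{D}$; $M(P_1,\dots,P_n)=M(\{P_1,\dots,P_n\})$. $\tilde e_i$ is the $i$-th standard basis vector of $\mathbb{R}^d$ and $\pi_i:\mathbb{R}^d\to\mathbb{R}^d$ is $\tilde x\mapsto x_i\tilde e_i$. *)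

(* Defs.v *)
From HB Require Import structures.
From mathcomp Require Import all_boot all_order all_algebra.
From mathcomp Require Import boolp classical_sets functions reals.
From mathcomp Require Import complex mpoly.
From mathcomp Require Import ring lra.

Set Implicit Arguments.
Unset Strict Implicit.
Unset Printing Implicit Defensive.

Import Order.TTheory GRing.Theory Num.Theory.

Local Open Scope classical_set_scope.
Local Open Scope ring_scope.

(* Elimination of one variable t from a system of inequalities
   a * t + ev g <= 0; used to see that Minkowski sums of polyhedra are
   polyhedra. *)
Section FourierMotzkin.
Context {R : realFieldType}.

Lemma separate (L U : seq R) :
  (forall l u, l \in L -> u \in U -> l <= u) ->
  exists t, (forall l, l \in L -> l <= t) /\ (forall u, u \in U -> t <= u).
Proof.
case: L => [|l0 L] LU.
  elim: U {LU} => [|u U [t [_ tU]]]; first by exists 0.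
  exists (Num.min u t); split=> // v; rewrite inE => /orP[/eqP->|/tU].
    by rewrite ge_min lexx.
  by move=> tv; rewrite ge_min tv orbT.
suff [t [tl tL]] : exists t, t \in l0 :: L /\ forall l, l \in l0 :: L -> l <= t.
  by exists t; split=> // u; apply: LU.
elim: L {LU} => [|l L [t [tin tL]]].
  by exists l0; rewrite mem_head; split=> // l; rewrite inE => /eqP->.
exists (Num.max l t); split.
  rewrite maxEle; case: ifP => _; last by rewrite !inE eqxx orbT.
  by move: tin; rewrite !inE => /orP[->//|->]; rewrite !orbT.
move=> m; rewrite !inE le_max => /or3P[/eqP->|/eqP->|mL].
- by rewrite (tL l0) ?mem_head ?orbT.
- by rewrite lexx.
- by rewrite (tL m) ?orbT// inE mL orbT.
Qed.

Definition fm_elim (G : lmodType R) (s : seq (R * G)) : seq G :=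
  [seq p.2 | p <- s & p.1 == 0] ++
  [seq p.1 *: q.2 - q.1 *: p.2 | p <- [seq p <- s | 0 < p.1],
                                 q <- [seq q <- s | q.1 < 0]].

Lemma fm_elimP (G : lmodType R) (s : seq (R * G)) (ev : G -> R) :
  scalar ev ->
  (exists t, forall p, p \in s -> p.1 * t + ev p.2 <= 0) <->
  (forall g, g \in fm_elim s -> ev g <= 0).
Proof.
move=> evL.
have ev0 : ev 0 = 0.
  by have := evL (-1) 0 0; rewrite scaler0 addr0 mulN1r addNr.
have evZ a x : ev (a *: x) = a * ev x.
  by rewrite -[a *: x]addr0 evL ev0 addr0.
have evB a b x y : ev (a *: x - b *: y) = a * ev x - b * ev y.
  by rewrite evL -scaleNr evZ mulNr.
split=> [[t st] g|sF].
  rewrite mem_cat => /orP[/mapP[p]|/allpairsP[[p q] /= []]].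
    by rewrite mem_filter => /andP[/eqP p0 /st]; rewrite p0 mul0r add0r => ? ->.
  rewrite !mem_filter => /andP[p0 /st ps] /andP[q0 /st qs] ->.
  rewrite evB.
  have : p.1 * (q.1 * t + ev q.2) <= 0 by rewrite pmulr_rle0.
  have : 0 <= q.1 * (p.1 * t + ev p.2) by rewrite nmulr_rge0.
  by lra.
pose L := [seq - ev q.2 / q.1 | q <- s & q.1 < 0].
pose U := [seq - ev p.2 / p.1 | p <- s & 0 < p.1].
have [|t [tL tU]] := @separate L U.
  move=> l u /mapP[q]; rewrite mem_filter => /andP[q0 qs] ->.
  move=> /mapP[p]; rewrite mem_filter => /andP[p0 ps] ->.
  have : ev (p.1 *: q.2 - q.1 *: p.2) <= 0.
    apply: sF; rewrite mem_cat; apply/orP; right.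
    by apply/allpairsP; exists (p, q); rewrite !mem_filter p0 q0 ps qs.
  rewrite evB => h.
  rewrite ler_ndivrMr// mulrAC ler_pdivrMr//; lra.
exists t => p ps; case: (ltgtP p.1 0) => p0.
- have : - ev p.2 / p.1 <= t.
    by apply/tL/mapP; exists p; rewrite // mem_filter p0.
  rewrite ler_ndivrMr//; lra.
- have : t <= - ev p.2 / p.1.
    by apply/tU/mapP; exists p; rewrite // mem_filter p0.
  rewrite ler_pdivlMr//; lra.
- rewrite p0 mul0r add0r; apply: sF; rewrite mem_cat; apply/orP; left.
  by apply/mapP; exists p; rewrite // mem_filter p0 eqxx.
Qed.

Lemma mul_row_cons n (t : R) (y : 'rV[R]_n) (v : 'cV[R]_(1 + n)) :
  (row_mx t%:M y *m v) 0 0 = v 0 0 * t + (y *m dsubmx v) 0 0.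
Proof.
rewrite -{1}[v]vsubmxK mul_row_col !mxE; congr (_ + _).
by rewrite big_ord1 !mxE eqxx mulr1n lshift0 mulrC.
Qed.

Lemma row_consE n (x : 'rV[R]_(1 + n)) :
  x = row_mx (x 0 0)%:M (rsubmx x).
Proof.
rewrite -{1}[x]hsubmxK; congr row_mx.
by rewrite [LHS]mx11_scalar !mxE lshift0.
Qed.

Lemma eliminate n (G : lmodType R) (s : seq ('cV[R]_n * G)) :
  exists s' : seq G, forall ev : G -> R, scalar ev ->
  (exists y : 'rV[R]_n, forall p, p \in s -> (y *m p.1) 0 0 + ev p.2 <= 0) <->
  (forall g, g \in s' -> ev g <= 0).
Proof.
elim: n G s => [|n IH] G s.
  exists [seq p.2 | p <- s] => ev _; split=> [[y ys] g /mapP[p ps ->]|h].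
    by have := ys _ ps; rewrite mxE big_ord0 add0r.
  by exists 0 => p ps; rewrite mxE big_ord0 add0r; apply/h/map_f.
pose s1 := [seq (p.1 0 0, (dsubmx p.1, p.2)) | p : 'cV[R]_(1 + n) * G <- s].
have [s' s'P] := IH G (fm_elim s1).
exists s' => ev evL; rewrite -s'P//.
have evyL (y : 'rV_n) :
    scalar (fun g : 'cV[R]_n * G => (y *m g.1) 0 0 + ev g.2).
  move=> a [u g] [v h] /=; rewrite evL mulmxDr -scalemxAr !mxE; ring.
split=> [[y ys]|[y ys]].
  exists (rsubmx (y : 'rV_(1 + n))).
  apply/(fm_elimP _ (evyL _)); exists (y 0 0) => _ /mapP[p ps ->] /=.
  have := ys _ ps; rewrite {1}[y]row_consE mul_row_cons; lra.
have /(fm_elimP _ (evyL y))[t ts] := ys.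
exists (row_mx t%:M y) => p ps.
have := ts _ (map_f _ ps) => /=.
by rewrite mul_row_cons addrA.
Qed.

End FourierMotzkin.

(* The lemma chi at the end of this section says that the Euler characteristic
   exists: a linear relation between indicator functions of closed polyhedra
   is still satisfied after each indicator [P] is replaced by 1 if P is
   nonempty and by 0 otherwise. The Minkowski product is well defined because
   the value of [A + B] at z is that of [A :&: (z - B)] under chi. *)
Section EulerCharacteristic.
Context {R : realFieldType}.

Definition near0 (P : R -> Prop) :=
  exists2 e0 : R, 0 < e0 & forall e, 0 < e -> e <= e0 -> P e.

Lemma near0_all (T : eqType) (P : T -> R -> Prop) (s : seq T) :
  (forall x, near0 (P x)) -> near0 (fun e => forall x, x \in s -> P x e).
Proof.
move=> nP; elim: s => [|x s [d d0 IH]]; first by exists 1.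
have [c c0 xP] := nP x; exists (Num.min c d); first by rewrite lt_min c0.
move=> e e0; rewrite le_min => /andP[ec ed] y; rewrite inE => /orP[/eqP->|ys].
  exact: xP.
exact: IH.
Qed.

Definition sat1 (l : seq (R * R)) (t : R) := all (fun h => h.1 * t <= h.2) l.
Definition sat1_left (l : seq (R * R)) (t : R) :=
  all (fun h => if h.1 < 0 then h.1 * t < h.2 else h.1 * t <= h.2) l.
Definition sat1_ninfty (l : seq (R * R)) :=
  all (fun h => (0 < h.1) || (h.1 == 0) && (0 <= h.2)) l.

Lemma sat1_leftP l t : near0 (fun e => sat1 l (t - e) = sat1_left l t).
Proof.
suff [d d0 H] : near0 (fun e => forall h, h \in l ->
    (h.1 * (t - e) <= h.2) =
    (if h.1 < 0 then h.1 * t < h.2 else h.1 * t <= h.2)).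
  by exists d => // e e0 ed; apply: eq_in_all => h; apply: H.
apply: near0_all => -[a b] /=; case: ltP => a0.
  have [atb|atb] := ltP (a * t) b.
    exists ((b - a * t) / - a).
      by rewrite divr_gt0 ?subr_gt0 ?oppr_gt0.
    move=> e e0; rewrite ler_pdivlMr ?oppr_gt0// => he; apply/idP; lra.
  exists 1 => // e e0 _; apply/negP => h.
  have : a * e < 0 by rewrite nmulr_rlt0.
  lra.
have [atb|atb] := leP (a * t) b.
  exists 1 => // e e0 _; have : 0 <= a * e by rewrite mulr_ge0// ltW.
  by move=> ?; apply/idP; lra.
exists ((a * t - b) / (a + 1) / 2).
  by rewrite !divr_gt0 ?subr_gt0//; lra.
move=> e e0; rewrite ler_pdivlMr// ler_pdivlMr; last lra.
by move=> he; apply/negP => h; nra.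
Qed.

Lemma sat1_ninftyP l : near0 (fun e => sat1 l (- e^-1) = sat1_ninfty l).
Proof.
suff [d d0 H] : near0 (fun e => forall h, h \in l ->
    (h.1 * (- e^-1) <= h.2) = ((0 < h.1) || (h.1 == 0) && (0 <= h.2))).
  by exists d => // e e0 ed; apply: eq_in_all => h; apply: H.
apply: near0_all => -[a b] /=.
have b1 : 0 < `|b| + 1 by rewrite ltr_wpDl.
have nb := ler_norm b; have nb' := lerNnormlW (lexx `|b|).
case: ltgtP => [a0|a0|<-] /=.
- exists (a / (`|b| + 1)); first by rewrite divr_gt0.
  move=> e e0; rewrite ler_pdivlMr// => he; apply/idP.
  rewrite mulrN -mulNr ler_pdivrMr//; nra.
- exists (- a / (`|b| + 1) / 2); first by rewrite !divr_gt0// oppr_gt0.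
  move=> e e0; rewrite ler_pdivlMr// ler_pdivlMr// => he; apply/negP.
  rewrite mulrN -mulNr ler_pdivrMr//; nra.
- by exists 1; [exact: ltr01|move=> e _ _; rewrite mul0r].
Qed.

Lemma seq_max (s : seq R) : s != [::] ->
  exists2 x, x \in s & forall y, y \in s -> y <= x.
Proof.
case: s => // a s _.
have [t [st _]] := @separate R (a :: s) [::] (fun _ _ _ H => False_ind _ (notF H)).
elim: s a {st t} => [|b s IH] a.
  by exists a; rewrite ?mem_head// => y; rewrite inE => /eqP->.
have [x xs xM] := IH b; have [ax|xa] := leP a x.
  exists x; first by rewrite inE xs orbT.
  by move=> y; rewrite inE => /orP[/eqP->|/xM].
exists a; first exact: mem_head.
move=> y; rewrite inE => /orP[/eqP->//|/xM yx].
exact: le_trans yx (ltW xa).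
Qed.

Lemma sat1_left_sat1 l t : sat1_left l t -> sat1 l t.
Proof. by apply: sub_all => h; case: ifP => // _ /ltW. Qed.

Definition lower_ends (l : seq (R * R)) := [seq h.2 / h.1 | h <- l & h.1 < 0].

Lemma sat1_count (C : nzRingType) l (X : seq R) :
  uniq X -> {subset lower_ends l <= X} ->
  (`[< exists t, sat1 l t >])%:R =
  (sat1_ninfty l)%:R + \sum_(x <- X) ((sat1 l x)%:R - (sat1_left l x)%:R) :> C.
Proof.
move=> uX lX; have [[t lt]|nsat] := pselect (exists t, sat1 l t); last first.
  rewrite asboolF//; have -> : sat1_ninfty l = false.
    apply/negP => l0; apply: nsat; have [e e0 /(_ e e0 (lexx _))] := sat1_ninftyP l.
    by rewrite l0 => h; exists (- e^-1).
  rewrite add0r big1// => x _.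
  have -> : sat1 l x = false by apply/negP => h; apply: nsat; exists x.
  rewrite (_ : sat1_left l x = false) ?subrr//.
  by apply/negP => /sat1_left_sat1 h; apply: nsat; exists x.
rewrite asboolT; last by exists t.
have [l0|lN0] := eqVneq (lower_ends l) [::].
  have lge h : h \in l -> (h.1 < 0) = false.
    move=> hl; apply/negP => h0.
    have : h.2 / h.1 \in lower_ends l.
      by apply/mapP; exists h; rewrite // mem_filter h0.
    by rewrite l0.
  have -> : sat1_ninfty l = true.
    apply/allP => h hl; have := lge _ hl; case: ltgtP => //= h0 _.
    by have /= := allP lt _ hl; rewrite h0 mul0r.
  rewrite big1 ?addr0// => x _; rewrite (_ : sat1_left l x = sat1 l x) ?subrr//.
  by apply: eq_in_all => h /lge ->.
have [x0 x0l x0M] := seq_max lN0.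
have -> : sat1_ninfty l = false.
  case/mapP: x0l => h; rewrite mem_filter => /andP[h0 hl] _.
  by apply/negP => /allP/(_ _ hl); case: ltgtP h0.
rewrite (bigD1_seq x0) ?lX//= big1 => [|x xx0].
  have x0t : x0 <= t.
    case/mapP: x0l => h; rewrite mem_filter => /andP[h0 hl] ->.
    by rewrite ler_ndivrMr// mulrC; exact: (allP lt).
  have -> : sat1 l x0.
    apply/allP => h hl; have := allP lt _ hl; case: (ltP h.1 0) => h0.
      have : h.2 / h.1 <= x0.
        by apply/x0M/mapP; exists h; rewrite // mem_filter h0.
      by rewrite ler_ndivrMr// mulrC.
    by apply: le_trans; rewrite ler_wpM2l.
  rewrite (_ : sat1_left l x0 = false) ?subr0 ?addr0 ?add0r//.
  case/mapP: x0l => h; rewrite mem_filter => /andP[h0 hl] x0E.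
  apply/negP => /allP/(_ _ hl); rewrite h0 x0E mulrC divfK ?ltxx//.
  by rewrite lt_eqF.
case: (ltgtP x x0) xx0 => // xx0 _.
  rewrite (_ : sat1 l x = false).
    by rewrite (contraFF (@sat1_left_sat1 l x)) ?subrr//;
       apply/negP; case/mapP: x0l xx0 => h; rewrite mem_filter => /andP[h0 hl] ->;
       rewrite ltr_ndivlMr// mulrC => hx /allP/(_ _ hl); rewrite leNgt hx.
  apply/negP; case/mapP: x0l xx0 => h; rewrite mem_filter => /andP[h0 hl] ->.
  by rewrite ltr_ndivlMr// mulrC => hx /allP/(_ _ hl); rewrite leNgt hx.
rewrite (_ : sat1_left l x = sat1 l x) ?subrr//.
apply: eq_in_all => h hl; case: ifP => // h0.
have : h.2 / h.1 < x.
  apply: le_lt_trans xx0.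
  by apply/x0M/mapP; exists h; rewrite // mem_filter h0.
by rewrite ltr_ndivrMr// mulrC => hx; rewrite hx (ltW hx).
Qed.

Lemma chi1 (C : nzRingType) (s : seq (C * seq (R * R))) :
  (forall t, \sum_(p <- s) p.1 * (sat1 p.2 t)%:R = 0) ->
  \sum_(p <- s) p.1 * (`[< exists t, sat1 p.2 t >])%:R = 0.
Proof.
move=> s0.
pose X := undup (flatten [seq lower_ends p.2 | p <- s]).
have sX p : p \in s -> {subset lower_ends p.2 <= X}.
  move=> ps x xp; rewrite mem_undup; apply/flattenP.
  by exists (lower_ends p.2) => //; apply/map_f.
rewrite (eq_big_seq (fun p : C * seq (R * R) => p.1 * (sat1_ninfty p.2)%:R +
    \sum_(x <- X) p.1 * ((sat1 p.2 x)%:R - (sat1_left p.2 x)%:R))); last first.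
  by move=> p /sX pX; rewrite (sat1_count _ _ pX) ?undup_uniq// mulrDr mulr_sumr.
rewrite big_split exchange_big/= (_ : \sum_(p <- s) _ = 0) ?add0r; last first.
  have [d d0 /(_ d d0 (lexx _)) H] :=
    near0_all s (fun p => @sat1_ninftyP p.2).
  by rewrite -[RHS](s0 (- d^-1)); apply: eq_big_seq => p /H ->.
apply: big1 => x _; under eq_bigr do rewrite mulrBr.
rewrite sumrB s0 sub0r (_ : \sum_(p <- s) _ = 0) ?oppr0//.
have [d d0 /(_ d d0 (lexx _)) H] :=
  near0_all s (fun p => @sat1_leftP p.2 x).
by rewrite -[RHS](s0 (x - d)); apply: eq_big_seq => p /H ->.
Qed.

Definition sat n (q : seq ('cV[R]_n * R)) (x : 'rV[R]_n) :=
  all (fun h => (x *m h.1) 0 0 <= h.2) q.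

Lemma sat_evalP n (q : seq ('cV[R]_n * R)) (x : 'rV[R]_n) :
  sat q x <-> forall h, h \in q -> (x *m h.1) 0 0 - h.2 <= 0.
Proof.
split=> [/allP xq h /xq|xq]; first by rewrite subr_le0.
by apply/allP => h /xq; rewrite subr_le0.
Qed.

Lemma eval_scalar n (x : 'rV[R]_n) :
  scalar (fun h : 'cV[R]_n * R^o => (x *m h.1) 0 0 - h.2).
Proof.
move=> a [u b] [v c] /=; rewrite mulmxDr -scalemxAr !mxE.
by rewrite /GRing.scale/=; ring.
Qed.

Lemma chi (C : nzRingType) n (s : seq (C * seq ('cV[R]_n * R))) :
  (forall x, \sum_(p <- s) p.1 * (sat p.2 x)%:R = 0) ->
  \sum_(p <- s) p.1 * (`[< exists x, sat p.2 x >])%:R = 0.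
Proof.
elim: n s => [|n IH] s s0.
  rewrite -[RHS](s0 0); apply: eq_bigr => p _; congr (_ * (nat_of_bool _)%:R).
  by apply/asboolP/idP => [[x]|]; [rewrite [x]thinmx0|exists 0].
pose proj (q : seq ('cV[R]_(1 + n) * R)) : seq ('cV[R]_n * R) :=
  fm_elim (G := ('cV[R]_n * R^o)%type) [seq (h.1 0 0, (dsubmx h.1, h.2)) | h : 'cV[R]_(1 + n) * R <- q].
have projP q (x : 'rV_n) :
    sat (proj q) x <-> exists t, sat (n := 1 + n) q (row_mx t%:M x).
  rewrite sat_evalP -(fm_elimP _ (eval_scalar x)).
  split=> -[t tq]; exists t.
    apply/sat_evalP => h hq; have /= := tq _ (map_f _ hq).
    by rewrite mul_row_cons addrA.
  move=> _ /mapP[h hq ->] /=; have /sat_evalP/(_ _ hq) := tq.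
  by rewrite mul_row_cons addrA.
have H := IH [seq (p.1, proj p.2) | p <- s]; rewrite big_map/= in H.
rewrite -[RHS]H.
  apply: eq_bigr => p _; congr (_ * (nat_of_bool _)%:R).
  apply/asboolP/asboolP => [[x xp]|[x /projP[t tx]]]; last by exists (row_mx t%:M x).
  exists (rsubmx (x : 'rV_(1 + n))); apply/projP; exists (x 0 0).
  by rewrite -row_consE.
move=> x; rewrite big_map /=.
pose fib (q : seq ('cV[R]_(1 + n) * R)) :=
  [seq (h.1 0 0, h.2 - (x *m dsubmx h.1) 0 0) | h : 'cV[R]_(1 + n) * R <- q].
have fibP q t : sat1 (fib q) t = sat (n := 1 + n) q (row_mx t%:M x).
  rewrite /sat1 all_map; apply: eq_all => h /=.
  by rewrite mul_row_cons lerBrDr.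
have H1 := @chi1 C [seq (p.1, fib p.2) | p <- s]; rewrite big_map/= in H1.
rewrite -[RHS]H1.
  apply: eq_bigr => p _; congr (_ * (nat_of_bool _)%:R).
  apply/idP/asboolP => [/projP[t tp]|[t tp]]; first by exists t; rewrite fibP.
  by apply/projP; exists t; rewrite -fibP.
by move=> t; rewrite big_map; under eq_bigr do rewrite fibP; exact: s0.
Qed.

End EulerCharacteristic.

Section Polyhedra.
Context {R : realType} {d : nat}.
Local Notation C := (R[i]).
Local Notation W := ('rV[R]_d).

(* Finite intersections of closed halfspaces; a zero normal vector h.1 is
   harmless, it gives the empty set or the whole space. *)
Definition is_polyhedron (P : set W) :=
  exists s : seq ('cV[R]_d * R),
    P = [set x | forall h, h \in s -> (x *m h.1) 0 0 <= h.2].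

Record polyhedron := Polyhedron {
  pset :> set W;
  psetP : is_polyhedron pset
}.

Definition indicator (P : set W) : W -> C^o := fun x => (x \in P)%:R.

Definition halfspaces (P : polyhedron) := projT1 (cid (psetP P)).

Lemma halfspacesP (P : polyhedron) x : (x \in (P : set W)) = sat (halfspaces P) x.
Proof.
rewrite /halfspaces; case: cid => s /= ->.
apply/idP/allP => [|h]; first by rewrite inE.
by rewrite inE.
Qed.

Lemma minkowski_sum_is_polyhedron (A B : polyhedron) :
  is_polyhedron [set x + y | x in A & y in B].
Proof.
pose s : seq ('cV[R]_d * ('cV[R]_d * R^o)) :=
  [seq (h.1, (0, h.2)) | h : 'cV[R]_d * R <- halfspaces A] ++
  [seq (- h.1, (h.1, h.2)) | h : 'cV[R]_d * R <- halfspaces B].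
have [s' s'P] := eliminate s; exists s'; apply/seteqP.
have key (z : W) : (exists y : W, forall p, p \in s ->
      (y *m p.1) 0 0 + ((z *m p.2.1) 0 0 - p.2.2) <= 0) <->
    exists2 y, y \in (A : set W) & z - y \in (B : set W).
  have z0 : (z *m (0 : 'cV[R]_d)) 0 (0 : 'I_1) = 0 by rewrite mulmx0 mxE.
  split=> [[y ys]|[y yA yB]]; exists y.
  - rewrite halfspacesP; apply/allP => h hA.
    have := ys (h.1, (0, h.2)); rewrite mem_cat map_f// => /(_ isT) /=.
    by rewrite z0 sub0r subr_le0.
  - rewrite halfspacesP; apply/allP => h hB.
    have := ys (- h.1, (h.1, h.2)).
    rewrite mem_cat (map_f (fun h => (- h.1, (h.1, h.2))))// orbT => /(_ isT) /=.
    by rewrite mulmxN mulmxBl !mxE; lra.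
  - move=> p; rewrite mem_cat => /orP[] /mapP[h hs ->] /=.
      move: yA; rewrite halfspacesP => /allP/(_ _ hs).
      by rewrite z0 sub0r subr_le0.
    move: yB; rewrite halfspacesP => /allP/(_ _ hs).
    by rewrite mulmxN mulmxBl !mxE; lra.
have zP (z : W) : (exists2 y, y \in (A : set W) & z - y \in (B : set W)) <->
    (forall h, h \in s' -> (z *m h.1) 0 0 <= h.2).
  rewrite -key (s'P _ (eval_scalar z)).
  by split=> H h /H; rewrite subr_le0.
split=> z /=.
  case=> x Ax [y By <-]; apply/zP; exists x; first by rewrite inE.
  by rewrite addrC addKr inE.
move=> /zP[y]; rewrite !inE => Ay Bzy.
by exists y => //; exists (z - y) => //; rewrite addrC subrK.
Qed.

Definition minkowski_sum (A B : polyhedron) : polyhedron :=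
  Polyhedron (minkowski_sum_is_polyhedron A B).

Lemma point_is_polyhedron (a : W) : is_polyhedron [set a].
Proof.
exists ([seq (delta_mx i 0, a 0 i) | i : 'I_d] ++
        [seq (- delta_mx i 0, - a 0 i) | i : 'I_d]).
have mul_delta (x : W) i : (x *m delta_mx i (0 : 'I_1)) 0 0 = x 0 i.
  rewrite mxE (bigD1 i)//= big1 => [|j ji]; first by rewrite !mxE !eqxx mulr1 addr0.
  by rewrite !mxE (negbTE ji) mulr0.
have mul_deltaN (x : W) i : (x *m - delta_mx i (0 : 'I_1)) 0 0 = - x 0 i.
  by rewrite mulmxN -mul_delta [LHS]mxE.
apply/seteqP; split=> x /= => [-> h|H].
  by rewrite mem_cat => /orP[] /mapP[i _ ->] /=; rewrite ?mul_deltaN ?mul_delta.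
apply/rowP => i; apply/eqP; rewrite eq_le; apply/andP; split.
  rewrite -(mul_delta x); apply: (H (delta_mx i 0, a 0 i)).
  by rewrite mem_cat; apply/orP; left; apply/mapP; exists i; rewrite ?mem_enum.
rewrite -lerN2 -(mul_deltaN x); apply: (H (- delta_mx i 0, - a 0 i)).
by rewrite mem_cat; apply/orP; right; apply/mapP; exists i; rewrite ?mem_enum.
Qed.

Definition point_polyhedron (a : W) : polyhedron := Polyhedron (point_is_polyhedron a).

Implicit Types s r q : seq (C * polyhedron).

Definition comb s : W -> C^o := \sum_(p <- s) p.1 *: indicator p.2.

Lemma combE s x : comb s x = \sum_(p <- s) p.1 * (x \in (p.2 : set W))%:R.
Proof. by rewrite /comb fct_sumE. Qed.

Definition comb_mul s r :=
  [seq (a.1 * b.1, minkowski_sum a.2 b.2) | a <- s, b <- r].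

Lemma comb_mulE s r x :
  comb (comb_mul s r) x =
  \sum_(a <- s) \sum_(b <- r)
    a.1 * b.1 * (x \in [set y + z | y in (a.2 : set W) & z in (b.2 : set W)])%:R.
Proof. by rewrite combE big_allpairs_dep. Qed.

Lemma comb_mul0 s (B : polyhedron) z :
  (forall x, comb s x = 0) ->
  \sum_(a <- s) a.1 * (z \in [set x + y | x in (a.2 : set W) & y in (B : set W)])%:R
    = 0.
Proof.
move=> s0.
pose r := [seq (- h.1, h.2 - (z *m h.1) 0 0) | h : 'cV[R]_d * R <- halfspaces B].
have rP y : sat r y = (z - y \in (B : set W)).
  rewrite halfspacesP /sat all_map; apply: eq_all => h /=.
  by rewrite mulmxN mulmxBl !mxE; apply/idP/idP; lra.
have H := @chi R C d [seq (a.1, halfspaces a.2 ++ r) | a <- s].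
rewrite big_map/= in H; rewrite -[RHS]H => [|x].
  apply: eq_bigr => a _; congr (_ * (nat_of_bool _)%:R).
  apply/idP/asboolP; rewrite inE.
    case=> x Ax [y By xyz]; exists x.
    rewrite /sat all_cat -!/(sat _ _) -halfspacesP rP -xyz addrC addKr.
    by apply/andP; split; apply/mem_set.
  case=> x; rewrite /sat all_cat -!/(sat _ _) -halfspacesP rP.
  by case/andP => /set_mem Ax /set_mem Bx; exists x => //; exists (z - x) => //; rewrite addrC subrK.
rewrite big_map/=.
transitivity (comb s x * (sat r x)%:R); last by rewrite s0 mul0r.
rewrite combE mulr_suml; apply: eq_bigr => a _.
by rewrite halfspacesP -mulrA -natrM mulnb /sat all_cat.
Qed.

Lemma comb_mulC s r : comb (comb_mul s r) = comb (comb_mul r s).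
Proof.
apply/funext => x; rewrite !comb_mulE exchange_big/=.
apply: eq_bigr => b _; apply: eq_bigr => a _; rewrite [a.1 * _]mulrC.
congr (_ * (nat_of_bool _)%:R); apply/idP/idP; rewrite !inE.
  by case=> y Ay [z Bz <-]; exists z => //; exists y => //; rewrite addrC.
by case=> y Ay [z Bz <-]; exists z => //; exists y => //; rewrite addrC.
Qed.

Lemma comb_mul_eql s s' r :
  comb s = comb s' -> comb (comb_mul s r) = comb (comb_mul s' r).
Proof.
move=> ss'; apply/funext => x; apply/eqP; rewrite -subr_eq0; apply/eqP.
have E s0 : comb (comb_mul s0 r) x = \sum_(b <- r) \sum_(a <- s0) a.1 * b.1 *
    (x \in [set y + z | y in (a.2 : set W) & z in (b.2 : set W)])%:R.
  by rewrite comb_mulE exchange_big.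
rewrite !E -sumrB.
apply: big1 => b _.
have H := @comb_mul0 (s ++ [seq (- a.1, a.2) | a <- s']) b.2 x.
have {}H : \sum_(a <- s ++ [seq (- a.1, a.2) | a <- s'])
    a.1 * (x \in [set x + y | x in (a.2 : set W) & y in (b.2 : set W)])%:R = 0.
  apply: H => y; rewrite combE big_cat big_map/= -combE ss' combE.
  by rewrite -[X in _ + X]opprK -sumrN; under [X in _ - X]eq_bigr do rewrite mulNr opprK; rewrite subrr.
rewrite big_cat big_map/= in H.
rewrite -[RHS](mul0r b.1) -[in RHS]H mulrDl !mulr_suml -sumrN.
congr (_ + _); apply: eq_bigr => a _; first by rewrite mulrAC.
by rewrite !mulNr [in RHS]mulrAC.
Qed.

Lemma comb_mulA s r q :
  comb (comb_mul s (comb_mul r q)) = comb (comb_mul (comb_mul s r) q).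
Proof.
apply/funext => x; rewrite !comb_mulE big_allpairs_dep/=.
apply: eq_bigr => a _; rewrite big_allpairs_dep/=.
apply: eq_bigr => b _; apply: eq_bigr => c _; rewrite mulrA.
congr (_ * (nat_of_bool _)%:R); apply/idP/idP; rewrite !inE.
  case=> y Ay [_ [z Bz [t Ct <-]] <-].
  by exists (y + z); [exists y => //; exists z|exists t; rewrite ?addrA].
case=> _ [y Ay [z Bz <-]] [t Ct <-].
by exists y => //; exists (z + t); [exists z => //; exists t|rewrite addrA].
Qed.

Lemma comb_mul1 s : comb (comb_mul [:: (1, point_polyhedron 0)] s) = comb s.
Proof.
apply/funext => x; rewrite comb_mulE big_seq1 combE; apply: eq_bigr => b _ /=.
rewrite mul1r; congr (_ * (nat_of_bool _)%:R); apply/idP/idP; rewrite !inE.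
  by case=> _ -> [z Bz <-]; rewrite add0r.
by move=> Bx; exists 0 => //; exists x; rewrite ?add0r.
Qed.

Lemma comb_cat s r : comb (s ++ r) = comb s + comb r.
Proof. by rewrite /comb big_cat. Qed.

Definition comb_scale (c : C) s := [seq (c * a.1, a.2) | a <- s].

Lemma comb_scaleE c s : comb (comb_scale c s) = c *: comb s.
Proof.
rewrite /comb big_map scaler_sumr; apply: eq_bigr => a _ /=.
by rewrite scalerA.
Qed.

(* C^o is C as a vector space over itself; the linear structure on
   W -> C^o is the pointwise one. *)
Definition polyhedral : {pred W -> C^o} :=
  fun f => `[< exists s, f = \sum_(p <- s) p.1 *: indicator p.2 >].

Lemma polyhedral_submod_closed : GRing.subsemimod_closed polyhedral.
Proof.
split=> [|c f /asboolP[s ->]].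
  split; first by apply/asboolP; exists [::]; rewrite big_nil.
  move=> f g /asboolP[s ->] /asboolP[r ->].
  by apply/asboolP; exists (s ++ r); rewrite big_cat.
by apply/asboolP; exists (comb_scale c s); exact: esym (comb_scaleE c s).
Qed.

HB.instance Definition _ :=
  GRing.isSubmodClosed.Build C (W -> C^o) polyhedral polyhedral_submod_closed.

Record poly_fun := PolyFun {
  poly_fun_val :> W -> C^o;
  _ : poly_fun_val \in polyhedral
}.

HB.instance Definition _ := [isSub for poly_fun_val].
HB.instance Definition _ := [Choice of poly_fun by <:].
HB.instance Definition _ := [SubChoice_isSubZmodule of poly_fun by <:].
HB.instance Definition _ := [SubZmodule_isSubLmodule of poly_fun by <:].

Lemma comb_polyhedral s : comb s \in polyhedral.
Proof. by apply/asboolP; exists s. Qed.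

Definition poly_comb s : poly_fun := PolyFun (comb_polyhedral s).

Lemma poly_funP (f : poly_fun) : exists s, f = poly_comb s.
Proof.
by case: f => f /= fP; have /asboolP[s fE] := fP; exists s; apply: val_inj.
Qed.

Definition decomposition (f : poly_fun) := projT1 (cid (poly_funP f)).

Lemma decompositionK f : poly_comb (decomposition f) = f.
Proof. by rewrite /decomposition; case: cid. Qed.

(* The product is computed on chosen decompositions of f and g as combinations
   of indicators; it does not depend on them by minkowski_mul_comb. *)
Definition minkowski_mul (f g : poly_fun) : poly_fun :=
  poly_comb (comb_mul (decomposition f) (decomposition g)).

Lemma minkowski_mul_comb s r :
  minkowski_mul (poly_comb s) (poly_comb r) = poly_comb (comb_mul s r).
Proof.
apply: val_inj => /=; set s' := decomposition _; set r' := decomposition _.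
have ss' : comb s' = comb s := congr1 val (decompositionK (poly_comb s)).
have rr' : comb r' = comb r := congr1 val (decompositionK (poly_comb r)).
by rewrite (comb_mul_eql _ ss') comb_mulC (comb_mul_eql _ rr') comb_mulC.
Qed.

Definition bracket (P : polyhedron) : poly_fun := poly_comb [:: (1, P)].

Lemma bracketE P : bracket P = indicator P :> (W -> C^o).
Proof. by rewrite /= /comb big_seq1 scale1r. Qed.

Lemma bracket_mul A B :
  minkowski_mul (bracket A) (bracket B) = bracket (minkowski_sum A B).
Proof.
by rewrite minkowski_mul_comb; congr poly_comb; rewrite /comb_mul/= mulr1.
Qed.

Lemma minkowski_mulA : associative minkowski_mul.
Proof.
move=> f g h; have [s ->] := poly_funP f; have [r ->] := poly_funP g.
have [q ->] := poly_funP h; rewrite !minkowski_mul_comb.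
by apply: val_inj; rewrite /= comb_mulA.
Qed.

Lemma minkowski_mulC : commutative minkowski_mul.
Proof. by move=> f g; apply: val_inj; rewrite /= comb_mulC. Qed.

Lemma minkowski_mul1 : left_id (bracket (point_polyhedron 0)) minkowski_mul.
Proof.
move=> f; have [s ->] := poly_funP f; rewrite minkowski_mul_comb.
by apply: val_inj; rewrite /= comb_mul1.
Qed.

Lemma minkowski_mulDl : left_distributive minkowski_mul +%R.
Proof.
move=> f g h; have [s ->] := poly_funP f; have [r ->] := poly_funP g.
have [q ->] := poly_funP h.
have -> : poly_comb s + poly_comb r = poly_comb (s ++ r).
  by apply: val_inj; rewrite /= comb_cat.
rewrite !minkowski_mul_comb; apply: val_inj; rewrite /= -comb_cat.
by rewrite /comb_mul allpairs_cat.
Qed.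

Lemma bracket_point0_neq0 : bracket (point_polyhedron 0) != 0.
Proof.
apply/eqP => /(congr1 (fun f : poly_fun => f 0)).
rewrite bracketE /indicator mem_set// => /eqP.
by rewrite (negbTE (@oner_neq0 C)).
Qed.

HB.instance Definition _ := GRing.Zmodule_isComNzRing.Build poly_fun
  minkowski_mulA minkowski_mulC minkowski_mul1 minkowski_mulDl
  bracket_point0_neq0.

Lemma minkowski_scalerAl (c : C) (f g : poly_fun) : c *: (f * g) = (c *: f) * g.
Proof.
have [s ->] := poly_funP f; have [r ->] := poly_funP g.
have scE q : c *: poly_comb q = poly_comb (comb_scale c q).
  by apply: val_inj; rewrite /= comb_scaleE.
rewrite scE [LHS](congr1 (GRing.scale c) (minkowski_mul_comb s r)).
rewrite [RHS]minkowski_mul_comb scE; apply: val_inj => /=; congr comb.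
rewrite /comb_scale /comb_mul map_allpairs allpairs_mapl.
by apply: eq_allpairs => // a b; rewrite mulrA.
Qed.

HB.instance Definition _ :=
  GRing.Lmodule_isLalgebra.Build C poly_fun minkowski_scalerAl.
HB.instance Definition _ := GRing.Lalgebra_isComAlgebra.Build C poly_fun.

End Polyhedra.
Arguments polyhedron R d : clear implicits.
Arguments poly_fun R d : clear implicits.

Section GeneratedSubalgebra.
Context {K : nzRingType} {A : comAlgType K}.
Variable S : set A.

Definition gen_subalg : {pred A} := fun x =>
  `[< forall B : {pred A}, GRing.subalg_closed B ->
      (forall s, S s -> s \in B) -> x \in B >].

Lemma gen_subalg_closed : GRing.subsemialg_closed gen_subalg.
Proof.
apply: GRing.subalg_closed_semi; split.
- by apply/asboolP => B [].
- move=> c x y /asboolP xS /asboolP yS; apply/asboolP => B Bc SB.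
  by have [_ + _] := Bc; apply; [exact: xS|exact: yS].
- move=> x y /asboolP xS /asboolP yS; apply/asboolP => B Bc SB.
  by have [_ _] := Bc; apply; [exact: xS|exact: yS].
Qed.

HB.instance Definition _ :=
  GRing.isSubalgClosed.Build K A gen_subalg gen_subalg_closed.

Record subalg := Subalg {
  subalg_val : A;
  _ : subalg_val \in gen_subalg
}.

HB.instance Definition _ := [isSub for subalg_val].
HB.instance Definition _ := [Choice of subalg by <:].
HB.instance Definition _ := [SubChoice_isSubComNzRing of subalg by <:].
HB.instance Definition _ := [SubZmodule_isSubLmodule of subalg by <:].
HB.instance Definition _ := [SubNzRing_SubLmodule_isSubLalgebra of subalg by <:].
HB.instance Definition _ := [SubLalgebra_isSubAlgebra of subalg by <:].

End GeneratedSubalgebra.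

Section AlgebraQuotient.
Context {K : nzRingType} {A : comAlgType K} (I : idealr A).

Definition alg_quot : Type := {ideal_quot I}.

HB.instance Definition _ := GRing.ComNzRing.copy alg_quot {ideal_quot I}.

Definition alg_quot_pi (x : A) : alg_quot := (\pi_{ideal_quot I} x)%qT.

Lemma alg_quot_piD : {morph alg_quot_pi : x y / x + y}.
Proof. exact: (rmorphD (\pi_{ideal_quot I})%qT). Qed.

Lemma alg_quot_piM : {morph alg_quot_pi : x y / x * y}.
Proof. exact: (rmorphM (\pi_{ideal_quot I})%qT). Qed.

Lemma alg_quot_pi1 : alg_quot_pi 1 = 1.
Proof. exact: (rmorph1 (\pi_{ideal_quot I})%qT). Qed.

Definition alg_quot_scale (c : K) (x : alg_quot) : alg_quot :=
  alg_quot_pi c%:A * x.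

Lemma alg_quot_scaleA a b x :
  alg_quot_scale a (alg_quot_scale b x) = alg_quot_scale (a * b) x.
Proof.
by rewrite /alg_quot_scale mulrA -alg_quot_piM -scalerAl mul1r scalerA.
Qed.

Lemma alg_quot_scale1 : left_id 1 alg_quot_scale.
Proof. by move=> x; rewrite /alg_quot_scale scale1r alg_quot_pi1 mul1r. Qed.

Lemma alg_quot_scaleDr : right_distributive alg_quot_scale +%R.
Proof. by move=> c x y; rewrite /alg_quot_scale mulrDr. Qed.

Lemma alg_quot_scaleDl x : {morph alg_quot_scale^~ x : a b / a + b}.
Proof.
by move=> a b; rewrite /alg_quot_scale scalerDl alg_quot_piD mulrDl.
Qed.

HB.instance Definition _ := GRing.Zmodule_isLmodule.Build K alg_quot
  alg_quot_scaleA alg_quot_scale1 alg_quot_scaleDr alg_quot_scaleDl.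

Lemma alg_quot_scalerAl (c : K) (x y : alg_quot) : c *: (x * y) = (c *: x) * y.
Proof. exact: mulrA. Qed.

HB.instance Definition _ :=
  GRing.Lmodule_isLalgebra.Build K alg_quot alg_quot_scalerAl.
HB.instance Definition _ := GRing.Lalgebra_isComAlgebra.Build K alg_quot.

End AlgebraQuotient.

Section GeneratedIdeal.
Context {A : comNzRingType} {n : nat}.

Definition gen_ideal (g : 'I_n -> A) : {pred A} :=
  fun x => `[< exists c : 'I_n -> A, x = \sum_i c i * g i >].

Lemma gen_ideal_closed g : 1 \notin gen_ideal g -> idealr_closed (gen_ideal g).
Proof.
move=> g1; split=> //.
  apply/asboolP; exists (fun=> 0).
  by rewrite big1// => i _; rewrite mul0r.
move=> a x y /asboolP[c ->] /asboolP[e ->].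
apply/asboolP; exists (fun i => a * c i + e i).
rewrite mulr_sumr -big_split; apply: eq_bigr => i _ /=.
by rewrite mulrDl mulrA.
Qed.

End GeneratedIdeal.

Section TensorProduct.
Context {K : nzRingType} {I : finType} (A : I -> algType K).

Definition multilinear (V : lmodType K) (f : (forall i, A i) -> V) :=
  forall (a : forall i, A i) (i : I), linear (fun x : A i => f (dfwith a x)).

(* The tensor product of algebras, up to isomorphism: the module is given by
   the universal property of the tensor product of modules, the product by
   (a_1 (x) .. (x) a_n)(b_1 (x) .. (x) b_n) = a_1 b_1 (x) .. (x) a_n b_n. *)
Definition is_tensor_product (T : algType K) (t : (forall i, A i) -> T) :=
  [/\ multilinear t,
      forall (V : lmodType K) (f : (forall i, A i) -> V), multilinear f ->
        exists g : {linear T -> V}, (forall a, g (t a) = f a) /\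
          forall h : {linear T -> V}, (forall a, h (t a) = f a) -> h =1 g,
      t (fun=> 1) = 1 &
      forall a b, t (fun i => a i * b i) = t a * t b].

End TensorProduct.
Arguments is_tensor_product {K I} A {T} t.

Notation minkowski_subalg D := (gen_subalg (bracket @` D)).
Notation minkowski_ring D := (subalg (bracket @` D)).

Section Boxes.
Context {R : realType}.

Definition box {d} (a b : 'I_d -> nat) : set 'rV[R]_d :=
  [set x | forall i, (a i)%:R <= x 0 i <= (b i)%:R].

Definition boxes d : set (polyhedron R d) :=
  [set P | exists a b : 'I_d -> nat,
     (forall i, (a i <= b i)%N) /\ P = box a b :> set _].

Definition unit_cube d : set 'rV[R]_d := box (fun=> 0%N) (fun=> 1%N).

Definition coord_proj {d} (i : 'I_d) (x : 'rV[R]_d) : 'rV[R]_d :=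
  x 0 i *: delta_mx 0 i.

Definition point_and_segment : set (polyhedron R 1) :=
  [set P | P = [set const_mx 1] :> set _ \/ P = @unit_cube 1 :> set _].

(* The variables of {mpoly R[i][d + d]} are x_1, .., x_d, y_1, .., y_d in this
   order. *)
Definition box_var_x d (i : 'I_d) : {mpoly R[i][d + d]} := 'X_(lshift d i).
Definition box_var_y d (i : 'I_d) : {mpoly R[i][d + d]} := 'X_(rshift d i).

Definition box_relation d (i : 'I_d) : {mpoly R[i][d + d]} :=
  (box_var_y i - 1) * (box_var_y i - box_var_x i).

Definition box_ideal d : {pred {mpoly R[i][d + d]}} :=
  gen_ideal (@box_relation d).

Lemma box_ideal_closed d : idealr_closed (@box_ideal d).
Proof.
apply: gen_ideal_closed; apply/negP => /asboolP[c].
move=> /(congr1 (meval (fun=> 1))); rewrite rmorph1 rmorph_sum big1.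
  by move/eqP; rewrite oner_eq0.
move=> i _; rewrite /= !rmorphM rmorphB rmorph1 /= mevalXU.
by rewrite subrr mul0r mulr0.
Qed.

HB.instance Definition _ d :=
  isIdealr.Build {mpoly R[i][d + d]} (@box_ideal d) (@box_ideal_closed d).

Definition box_algebra d := alg_quot (@box_ideal d).

End Boxes.
Arguments boxes R d : clear implicits.
Arguments unit_cube R d : clear implicits.
Arguments point_and_segment R : clear implicits.
Arguments box_ideal R d : clear implicits.
Arguments box_algebra R d : clear implicits.

Definition is_box_presentation {R : realType} {d : nat}
    (phi : {mpoly R[i][d + d]} -> minkowski_ring (boxes R d)) :=
  (forall i, poly_fun_val (subalg_val (phi (box_var_x i))) =
     indicator [set delta_mx 0 i]) /\
  (forall i, poly_fun_val (subalg_val (phi (box_var_y i))) =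
     indicator (coord_proj i @` unit_cube R d)).

(* Main.v *)
Require Import Defs.
From HB Require Import structures.
From mathcomp Require Import all_boot all_order all_algebra.
From mathcomp Require Import boolp classical_sets functions reals.
From mathcomp Require Import complex mpoly.
From mathcomp Require Import ring lra zify.

Set Implicit Arguments.
Unset Strict Implicit.
Unset Printing Implicit Defensive.

Import Order.TTheory GRing.Theory Num.Theory.

Local Open Scope classical_set_scope.
Local Open Scope ring_scope.

(* The relation (y_i - 1)(y_i - x_i) = 0 lowers the exponent of y_i to at most
   1, so in any algebra where it holds, the image of a polynomial is a linear
   combination of the monomials x^a y^s with s in {0,1}^d. In the Minkowski ring
   such a monomial is the box with corner a and side lengths s, and these boxes
   are linearly independent: evaluation at the centres of the boxes is triangular
   with respect to the number of nondegenerate sides. This gives the kernel, and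
   the same basis gives the universal property of the tensor product: the tuple
   (x^a1 y^s1, .., x^ad y^sd) of basis elements of the factors corresponds to the
   basis element x^a y^s. *)

(** * Linear combinations, spans and linear independence of families in modules *)

Section LinearCombinations.
Context {K : nzRingType} {J : eqType}.
Implicit Types (B V : lmodType K) (s : seq (K * J)).

Definition lincomb B (E : J -> B) s : B := \sum_(p <- s) p.1 *: E p.2.

Definition in_span B (E : J -> B) (b : B) : Prop := exists s, b = lincomb E s.

(** Coefficients are given by lists in which an index may be repeated, so the coefficient of [j] is
    the sum over all its occurrences. *)
Definition lin_indep B (E : J -> B) : Prop :=
  forall s, lincomb E s = 0 -> forall j, \sum_(p <- s | p.2 == j) p.1 = 0.

Lemma in_span_gen B (E : J -> B) j : in_span E (E j).
Proof. by exists [:: (1, j)]; rewrite /lincomb big_seq1 scale1r. Qed.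

Lemma in_span0 B (E : J -> B) : in_span E 0.
Proof. by exists [::]; rewrite /lincomb big_nil. Qed.

Lemma in_spanD B (E : J -> B) a b : in_span E a -> in_span E b -> in_span E (a + b).
Proof. by move=> [s ->] [r ->]; exists (s ++ r); rewrite /lincomb big_cat. Qed.

Lemma in_spanZ B (E : J -> B) c b : in_span E b -> in_span E (c *: b).
Proof.
move=> [s ->]; exists [seq (c * p.1, p.2) | p <- s].
rewrite /lincomb big_map scaler_sumr; apply: eq_bigr => p _ /=.
by rewrite scalerA.
Qed.

Lemma in_span_lincomb B (E : J -> B) (J' : eqType) (s : seq (K * J')) (F : J' -> B) :
  (forall j, in_span E (F j)) -> in_span E (\sum_(p <- s) p.1 *: F p.2).
Proof.
move=> EF; elim/big_rec: _ => [|p b _ Eb]; first exact: in_span0.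
exact/in_spanD/Eb/in_spanZ/EF.
Qed.

Lemma lincomb_map B V (E : J -> B) (g : {linear B -> V}) s :
  g (lincomb E s) = lincomb (g \o E) s.
Proof.
by rewrite /lincomb linear_sum; apply: eq_bigr => p _; rewrite linearZ.
Qed.

Lemma lincomb_fibers B (E : J -> B) s :
  lincomb E s =
  \sum_(j <- undup (map snd s)) (\sum_(p <- s | p.2 == j) p.1) *: E j.
Proof.
under eq_bigr do rewrite scaler_suml.
rewrite (exchange_big_dep predT)//= /lincomb; apply: eq_big_seq => p ps.
rewrite (eq_bigl (pred1 p.2)) => [|j]; last by rewrite eq_sym.
by rewrite -big_filter filter_pred1_uniq ?undup_uniq ?mem_undup ?map_f// big_seq1.
Qed.

(** In a relation between independent elements the total coefficient of each index vanishes, and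
    such a relation holds in every family. *)
Lemma lin_indep_eq0 B V (E : J -> B) (F : J -> V) s :
  lin_indep E -> lincomb E s = 0 -> lincomb F s = 0.
Proof.
move=> Ei /Ei s0; rewrite lincomb_fibers big1// => j _.
by rewrite s0 scale0r.
Qed.

(** The map is computed on a chosen decomposition [r b] of each [b]; independence makes the value
    the same for all decompositions, and this freedom gives linearity. *)
Lemma lin_indep_extend B V (E : J -> B) (F : J -> V) :
  (forall b, in_span E b) -> lin_indep E ->
  exists g : {linear B -> V}, forall j, g (E j) = F j.
Proof.
move=> /choice[r rE] Ei.
have wd s s' : lincomb E s = lincomb E s' -> lincomb F s = lincomb F s'.
  (* The difference of two combinations becomes a single list, to which independence applies. *)
  have cat_neg (V' : lmodType K) (G : J -> V') :
      lincomb G (s ++ [seq (- p.1, p.2) | p <- s']) = lincomb G s - lincomb G s'.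
    rewrite /lincomb big_cat big_map -sumrN; congr (_ + _).
    by apply: eq_bigr => p _; rewrite scaleNr.
  move=> /eqP; rewrite -subr_eq0 -cat_neg => /eqP /(lin_indep_eq0 F Ei)/eqP.
  by rewrite cat_neg subr_eq0 => /eqP.
pose g b := lincomb F (r b).
have gE b s : b = lincomb E s -> g b = lincomb F s.
  by move=> bs; apply: wd; rewrite -rE.
have gL : linear g.
  move=> c a b; pose s := [seq (c * p.1, p.2) | p <- r a] ++ r b.
  have sE (V' : lmodType K) (G : J -> V') :
      lincomb G s = c *: lincomb G (r a) + lincomb G (r b).
    rewrite /lincomb big_cat big_map scaler_sumr; congr (_ + _).
    by apply: eq_bigr => p _; rewrite scalerA.
  by rewrite (gE _ s) ?sE// -!rE.
pose gm := GRing.isLinear.Build K B V *:%R g gL.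
exists (HB.pack g gm : {linear B -> V}) => j /=.
by rewrite (gE _ [:: (1, j)]) /lincomb big_seq1 scale1r.
Qed.

(** Induction from large [mu] to small: applying [ev j] to a relation leaves the coefficient of [j]
    and those of indices with larger [mu], which vanish already. The bound [n] lets the induction
    start. *)
Lemma triangular_lin_indep B (E : J -> B) (mu : J -> nat) (n : nat)
    (ev : J -> {linear B -> K^o}) :
  (forall j, (mu j <= n)%N) -> (forall j, ev j (E j) = 1) ->
  (forall j k, k != j -> ev j (E k) != 0 -> (mu j < mu k)%N) ->
  lin_indep E.
Proof.
move=> mun ev1 ev0 s s0 j; have [m] := ubnP (n - mu j)%N.
elim: m j => // m IH j jm.
have := congr1 (ev j) s0; rewrite lincomb_map linear0 lincomb_fibers.
have [js|js] := boolP (j \in undup (map snd s)); last first.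
  move=> _; rewrite big_seq_cond big1// => p /andP[ps /eqP pj].
  by case/negP: js; rewrite mem_undup -pj map_f.
rewrite (bigD1_seq j) ?undup_uniq//= ev1 [X in _ + X]big1.
  by rewrite addr0 [_ *: _]mulr1.
move=> k kj; have [->|/(ev0 _ _ kj) jk] := eqVneq (ev j (E k)) 0.
  by rewrite scaler0.
by rewrite IH ?scale0r//; have := mun k; lia.
Qed.

End LinearCombinations.

(** * Multilinear maps on spanning families, and factorization through a surjection *)

Lemma multilinear_ext {K : nzRingType} {I : finType} {J : eqType} (B : algType K)
    (V : lmodType K) (E : J -> B) (f g : (I -> B) -> V) :
  (forall b, in_span E b) -> @multilinear K I (fun=> B) V f ->
  @multilinear K I (fun=> B) V g ->
  (forall k : I -> J, f (E \o k) = g (E \o k)) -> f =1 g.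
Proof.
move=> Esp fL gL fg a.
(* [l] contains the coordinates not yet known to be members of the family; each induction step
   expands one of them in the span. *)
suff H (l : seq I) : forall a : I -> B,
    (forall i, i \notin l -> exists j, a i = E j) -> f a = g a.
  by apply: (H (enum I)) => i; rewrite mem_enum.
elim: l => [|i l IH] {}a aE.
  have /choice[k kE] := fun i => aE i isT.
  by have -> : a = E \o k by apply/funext.
have [s sE] := Esp (a i).
(* Writing [a] as its own update at [i] exposes the slot in which linearity is used. *)
have aD : a = dfwith (T := fun=> B) a (i := i) (a i).
  by apply/funext => m; case: dfwithP.
have expand (h : (I -> B) -> V) : @multilinear K I (fun=> B) V h ->
    h a = \sum_(p <- s) p.1 *: h (dfwith (T := fun=> B) a (i := i) (E p.2)).
  move=> hL; pose ha (x : B) := h (dfwith (T := fun=> B) a (i := i) x).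
  pose hm := GRing.isLinear.Build K B V *:%R ha (hL a i).
  pose hi : {linear B -> V} := HB.pack ha hm.
  rewrite [in LHS]aD -[LHS]/(hi (a i)) sE /lincomb linear_sum.
  by apply: eq_bigr => p _; rewrite linearZ.
rewrite !expand//; apply: eq_bigr => p _; congr (_ *: _); apply: IH => m ml.
have [->|mi] := eqVneq m i; first by exists p.2; rewrite dfwith_in.
by rewrite dfwith_out 1?eq_sym//; apply: aE; rewrite inE negb_or mi.
Qed.

(** [chi] is [psi] on a chosen preimage; by the kernel condition the choice does not matter. *)
Lemma lrmorphism_factor {K : nzRingType} {A B C : lalgType K}
    (phi : {lrmorphism A -> B}) (psi : {lrmorphism A -> C}) :
  (forall b, exists a, phi a = b) -> (forall a, phi a = 0 -> psi a = 0) ->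
  exists chi : {lrmorphism B -> C}, forall a, chi (phi a) = psi a.
Proof.
move=> /choice[r rK] ker.
pose chi b := psi (r b).
have chiE a : chi (phi a) = psi a.
  apply/subr0_eq; rewrite /chi -linearB; apply: ker.
  by rewrite linearB /= rK subrr.
have chiL : linear chi.
  by move=> c a b; rewrite -[a]rK -[b]rK -linearP !chiE linearP.
have chiM : monoid_morphism chi.
  split=> [|a b]; first by rewrite -(rmorph1 phi) chiE rmorph1.
  by rewrite -[a]rK -[b]rK -rmorphM !chiE rmorphM.
pose cl := GRing.isLinear.Build K B C *:%R chi chiL.
pose cm := GRing.isMonoidMorphism.Build B C chi chiM.
by exists (HB.pack chi cl cm : {lrmorphism B -> C}).
Qed.

(** * Evaluation homomorphisms on polynomial algebras *)

Section MpolyEval.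
Context {K : nzRingType} {n : nat} {A : comAlgType K} (h : 'I_n -> A).

Definition mpoly_eval : {mpoly K[n]} -> A := mmap (in_alg A) h.

HB.instance Definition _ := GRing.RMorphism.copy mpoly_eval (mmap (in_alg A) h).

Lemma mpoly_eval_scalable : scalable mpoly_eval.
Proof. by move=> c p; rewrite /mpoly_eval mmapZ /= -scalerAl mul1r. Qed.

HB.instance Definition _ :=
  GRing.isScalable.Build K {mpoly K[n]} A *:%R mpoly_eval mpoly_eval_scalable.

Lemma mpoly_evalX i : mpoly_eval 'X_i = h i.
Proof. by rewrite /mpoly_eval mmapX mmap1U. Qed.

End MpolyEval.

Lemma mpoly_lrmorphism_ext {K : nzRingType} {n} {A : lalgType K}
    (phi psi : {lrmorphism {mpoly K[n]} -> A}) :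
  (forall i, phi 'X_i = psi 'X_i) -> phi =1 psi.
Proof.
move=> XE p; rewrite [p]mpolyE !linear_sum; apply: eq_bigr => m _.
rewrite !linearZ mpolyXE_id !rmorph_prod; congr (_ *: _).
by apply: eq_bigr => i _; rewrite !rmorphXn /= XE.
Qed.

(** * Spanning by the monomials x^a y^s with s in {0,1}^d *)

Section BoxMonomials.
Context {K : nzRingType} {d : nat}.
Implicit Types k : {ffun 'I_d -> nat * bool}.

(** The index [k] holds the exponent of x as a natural number and that of y as a boolean. The ring
    is arbitrary, so that these monomials can be carried along homomorphisms. *)
Definition box_monomial {A : comNzRingType} (x y : 'I_d -> A) k : A :=
  \prod_i (x i ^+ (k i).1 * y i ^+ (k i).2).

Lemma rmorph_box_monomial {A B : comNzRingType} (g : {rmorphism A -> B})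
    (x y : 'I_d -> A) k :
  g (box_monomial x y k) = box_monomial (g \o x) (g \o y) k.
Proof.
rewrite rmorph_prod; apply: eq_bigr => i _.
by rewrite rmorphM !rmorphXn.
Qed.

Lemma box_monomial0 {A : comNzRingType} (x y : 'I_d -> A) :
  box_monomial x y [ffun=> (0%N, false)] = 1.
Proof. by apply: big1 => i _; rewrite ffunE mulr1. Qed.

Context {A : comAlgType K} (x y : 'I_d -> A).
Hypothesis yx : forall i, (y i - 1) * (y i - x i) = 0.
Let E := box_monomial x y.

Let upd k (i : 'I_d) u : {ffun 'I_d -> nat * bool} :=
  [ffun j => if j == i then u else k j].
Let rest k i := \prod_(j | j != i) (x j ^+ (k j).1 * y j ^+ (k j).2).

Lemma box_monomialD1 k i : E k = x i ^+ (k i).1 * y i ^+ (k i).2 * rest k i.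
Proof. by rewrite /E /box_monomial (bigD1 i). Qed.

Lemma box_monomial_upd k i u : E (upd k i u) = x i ^+ u.1 * y i ^+ u.2 * rest k i.
Proof.
rewrite (box_monomialD1 _ i) /rest ffunE eqxx; congr (_ * _).
by apply: eq_bigr => j ji; rewrite ffunE (negbTE ji).
Qed.

Lemma in_span_mul (a b : A) :
  (forall k, in_span E (a * E k)) -> in_span E b -> in_span E (a * b).
Proof.
move=> aE [s ->]; rewrite /lincomb mulr_sumr.
under eq_bigr do rewrite -scalerAr.
exact: (in_span_lincomb s (F := fun k => a * E k)).
Qed.

Lemma in_span_mulx i k : in_span E (x i * E k).
Proof.
have -> : x i * E k = E (upd k i ((k i).1.+1, (k i).2)).
  by rewrite box_monomial_upd (box_monomialD1 k i) exprS !mulrA.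
exact: in_span_gen.
Qed.

(* The relation reads [y ^ 2 = y + x * y - x], which lowers the exponent of
   [y i] to at most 1. *)
Lemma in_span_muly i k : in_span E (y i * E k).
Proof.
case ki: (k i) => [a [|]]; last first.
  have -> : y i * E k = E (upd k i (a, true)).
    by rewrite box_monomial_upd (box_monomialD1 k i) ki /=; ring.
  exact: in_span_gen.
have -> : y i * E k = E (upd k i (a, true)) + E (upd k i (a.+1, true))
                      + (-1) *: E (upd k i (a.+1, false)).
  rewrite scaleN1r !box_monomial_upd (box_monomialD1 k i) ki /= !exprS.
  rewrite ?expr1 ?expr0 ?mulr1.
  apply/subr0_eq; rewrite -[RHS](mulr0 (x i ^+ a * rest k i)) -(yx i); ring.
by apply: in_spanD (in_spanZ _ (in_span_gen _ _)); apply: in_spanD;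
   exact: in_span_gen.
Qed.

End BoxMonomials.

(** Multiplication by the image of a variable preserves the span, hence so does multiplication by
    the image of any monomial; it is then applied to 1, the box monomial with zero exponents. *)
Lemma mpoly_in_span {K : nzRingType} {d : nat} {A : comAlgType K}
    (phi : {lrmorphism {mpoly K[d + d]} -> A}) :
  let x i := phi 'X_(lshift d i) in let y i := phi 'X_(rshift d i) in
  (forall i, (y i - 1) * (y i - x i) = 0) ->
  forall p, in_span (box_monomial x y) (phi p).
Proof.
move=> x y yx p.
pose stable a := forall b,
  in_span (box_monomial x y) b -> in_span (box_monomial x y) (a * b).
have stable1 : stable 1 by move=> b; rewrite mul1r.
have stableM a b : stable a -> stable b -> stable (a * b).
  by move=> sa sb c /sb /sa; rewrite mulrA.
have stableX i : stable (phi 'X_i).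
  move=> b; apply: in_span_mul => k; case: (split_ordP i) => j ->.
    exact: in_span_mulx.
  exact: in_span_muly.
rewrite [p]mpolyE linear_sum; elim/big_rec: _ => [|m q _ qE]; first exact: in_span0.
apply: in_spanD qE; rewrite linearZ /=; apply: in_spanZ.
rewrite -[phi _]mulr1; have : stable (phi 'X_[m]).
  rewrite mpolyXE_id rmorph_prod /=; elim/big_ind: _ => // i _.
  rewrite rmorphXn /=; elim: (m i) => [|n IH]; first by rewrite expr0.
  by rewrite exprS; exact: stableM (stableX i) IH.
by move=> H; apply: H; rewrite -(box_monomial0 x y); exact: in_span_gen.
Qed.

(** * Boxes in the Minkowski ring: generators, relations and independence *)

Section BoxBrackets.
Context {R : realType} {d : nat}.
Implicit Types (a s : 'I_d -> nat) (i : 'I_d).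
Local Notation C := (R[i]).
Local Notation M := (minkowski_ring (boxes R d)).

Lemma box_is_polyhedron (a b : 'I_d -> nat) : is_polyhedron (@box R d a b).
Proof.
exists ([seq (delta_mx i 0, (b i)%:R) | i : 'I_d] ++
        [seq (- delta_mx i 0, - (a i)%:R) | i : 'I_d]).
have mul_delta (x : 'rV[R]_d) i : (x *m delta_mx i (0 : 'I_1)) 0 0 = x 0 i.
  rewrite mxE (bigD1 i)//= big1 => [|j ji]; first by rewrite !mxE !eqxx mulr1 addr0.
  by rewrite !mxE (negbTE ji) mulr0.
have mul_deltaN (x : 'rV[R]_d) i : (x *m - delta_mx i (0 : 'I_1)) 0 0 = - x 0 i.
  by rewrite mulmxN -mul_delta [LHS]mxE.
apply/seteqP; split=> x /= => [xab h|H i].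
  by rewrite mem_cat => /orP[] /mapP[i _ ->] /=;
     have /andP[] := xab i; rewrite ?mul_deltaN ?mul_delta ?lerN2.
apply/andP; split.
  rewrite -lerN2 -(mul_deltaN x); apply: (H (- delta_mx i 0, - (a i)%:R)).
  by rewrite mem_cat; apply/orP; right; apply/mapP; exists i; rewrite ?mem_enum.
rewrite -(mul_delta x); apply: (H (delta_mx i 0, (b i)%:R)).
by rewrite mem_cat; apply/orP; left; apply/mapP; exists i; rewrite ?mem_enum.
Qed.

(* The second argument is the vector of side lengths, so that every pair of
   arguments gives a nonempty box. *)
Definition box_polyhedron a s : polyhedron R d :=
  Polyhedron (box_is_polyhedron a (fun i => a i + s i)%N).

Definition box_bracket a s : poly_fun R d := bracket (box_polyhedron a s).

Lemma bracket_ext (P Q : polyhedron R d) : P = Q :> set _ -> bracket P = bracket Q.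
Proof. by move=> PQ; apply: val_inj; rewrite [LHS]bracketE [RHS]bracketE PQ. Qed.

Lemma box_bracketE a s (x : 'rV[R]_d) :
  box_bracket a s x =
  [forall i, (a i)%:R <= x 0 i <= (a i + s i)%:R]%:R.
Proof.
rewrite /box_bracket bracketE /indicator; congr (nat_of_bool _)%:R.
by apply/idP/forallP; rewrite inE.
Qed.

Lemma box_bracketM a s a' s' :
  box_bracket a s * box_bracket a' s' =
  box_bracket (fun i => a i + a' i)%N (fun i => s i + s' i)%N.
Proof.
rewrite [LHS]bracket_mul; apply: bracket_ext => /=.
apply/seteqP; split=> [_ [y yas [z zas <-]] i|x xas].
  have := yas i; have := zas i; rewrite !mxE !natrD; lra.
(* The least [y] meeting both lower bounds, from [a <= y] and from [x - y <= a' + s']. *)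
pose y : 'rV[R]_d :=
  \row_i Num.max (a i)%:R (x 0 i - (a' i + s' i)%:R).
exists y => [i|].
  have := xas i; rewrite !mxE /Num.max !natrD.
  have : 0 <= (s i)%:R :> R by exact: ler0n.
  by case: ltP; lra.
exists (x - y) => [i|]; last by rewrite addrC subrK.
have := xas i; rewrite !mxE /Num.max !natrD.
have : 0 <= (s' i)%:R :> R by exact: ler0n.
by case: ltP; lra.
Qed.

Lemma eq_box_bracket a s a' s' : a =1 a' -> s =1 s' ->
  box_bracket a s = box_bracket a' s'.
Proof. by move=> /funext-> /funext->. Qed.

Lemma box_bracket1 : box_bracket (fun=> 0%N) (fun=> 0%N) = 1.
Proof.
apply: bracket_ext; apply/seteqP; split=> x /=.
  move=> x0; apply/rowP => i; rewrite mxE; apply/eqP.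
  by rewrite eq_le andbC; exact: x0.
by move=> -> i; rewrite mxE lexx.
Qed.

Lemma box_bracketX a s n :
  box_bracket a s ^+ n = box_bracket (fun i => n * a i)%N (fun i => n * s i)%N.
Proof.
elim: n => [|n IH]; first by rewrite expr0 -box_bracket1.
by rewrite exprS IH box_bracketM; apply: eq_box_bracket => i; rewrite mulSn.
Qed.

Lemma box_bracket_prod (I : Type) (r : seq I) (a s : I -> 'I_d -> nat) :
  \prod_(i <- r) box_bracket (a i) (s i) =
  box_bracket (fun j => \sum_(i <- r) a i j)%N (fun j => \sum_(i <- r) s i j)%N.
Proof.
elim: r => [|i r IH].
  by rewrite big_nil -box_bracket1; apply: eq_box_bracket => j; rewrite big_nil.
by rewrite big_cons IH box_bracketM; apply: eq_box_bracket => j; rewrite big_cons.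
Qed.

(** The vector n e_i. Thus [box_bracket (axis i 1) (axis i 0)] is the class of the point e_i, and
    [box_bracket (axis i 0) (axis i 1)] that of the unit segment on the i-th axis. *)
Definition axis i (n : nat) : 'I_d -> nat := fun j => (n * (j == i))%N.

(** A box is the Minkowski sum of [a i] copies of e_i and [s i] copies of the i-th unit segment,
    over all i. The side lengths are arbitrary here, so the points and segments generate the
    ring. *)
Lemma box_bracket_monomial a s :
  \prod_i (box_bracket (axis i 1) (axis i 0) ^+ a i *
           box_bracket (axis i 0) (axis i 1) ^+ s i) = box_bracket a s.
Proof.
under eq_bigr do rewrite !box_bracketX box_bracketM.
rewrite box_bracket_prod; apply: eq_box_bracket => j;
  rewrite (bigD1 j)//= big1 /axis ?eqxx => [|i ij]; rewrite ?[j == i]eq_sym ?(negbTE ij); lia.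
Qed.

Lemma box_bracket_axisE i m n (x : 'rV[R]_d) :
  box_bracket (axis i m) (axis i n) x =
  ([forall (j | j != i), x 0 j == 0] && (m%:R <= x 0 i <= (m + n)%:R))%:R.
Proof.
rewrite box_bracketE; congr (nat_of_bool _)%:R.
apply/forallP/andP => [xmn|[/forallP x0 xi] j].
  split; last by have := xmn i; rewrite /axis eqxx !muln1.
  apply/forallP => j; apply/implyP => ji; have := xmn j.
  by rewrite /axis (negbTE ji) !muln0 eq_le andbC.
rewrite /axis; have [->|ji] := eqVneq j i; first by rewrite !muln1.
by have := x0 j; rewrite ji !muln0 => /eqP->; rewrite lexx.
Qed.

(* The relation [y (y - x) = y - x] holds because subtracting [1, 2] from
   [0, 2] gives the same half-open interval as subtracting {1} from [0, 1]. *)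
Lemma box_bracket_relation i :
  let x := box_bracket (axis i 1) (axis i 0) in
  let y := box_bracket (axis i 0) (axis i 1) in
  (y - 1) * (y - x) = 0.
Proof.
move=> x y; transitivity (y * y - y * x - (y - x)); first by ring.
have -> : y * y = box_bracket (axis i 0) (axis i 2).
  by rewrite box_bracketM; apply: eq_box_bracket => j; rewrite /axis; lia.
have -> : y * x = box_bracket (axis i 1) (axis i 1).
  by rewrite box_bracketM; apply: eq_box_bracket => j; rewrite /axis; lia.
apply: val_inj; apply/funext => z.
rewrite -[LHS]/(box_bracket (axis i 0) (axis i 2) z
  - box_bracket (axis i 1) (axis i 1) z - (y z - x z)) -[RHS]/0.
(* Off the i-th axis all four indicators vanish. *)
rewrite /x /y !box_bracket_axisE; set Q := [forall (j | _), _]; case: Q; last by rewrite !subrr.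
rewrite !andTb !addn0 !add0n.
(* Only the position relative to 0, 1 and 2 matters; 1 is tested on both sides because closed
   intervals both end and begin there. *)
have [z0|z0] := leP 0%:R (z 0 i); have [z1|z1] := leP (z 0 i) 1%:R;
  have [z1'|z1'] := leP 1%:R (z 0 i); have [z2|z2] := leP (z 0 i) 2%:R;
  by [exfalso; lra | rewrite /= ?subrr ?subr0 ?sub0r ?opprK ?addNr ?subrr].
Qed.

Lemma box_bracket_in a s : box_bracket a s \in minkowski_subalg (boxes R d).
Proof.
apply/asboolP => B _; apply; exists (box_polyhedron a s) => //.
by exists a, (fun i => a i + s i)%N; split=> // i; rewrite leq_addr.
Qed.

Definition box_elt a s : M := Subalg (box_bracket_in a s).

Definition box_eval : {mpoly C[d + d]} -> M :=
  mpoly_eval (fun j : 'I_(d + d) => match fintype.split j with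
                       | inl i => box_elt (axis i 1) (axis i 0)
                       | inr i => box_elt (axis i 0) (axis i 1)
                       end).

HB.instance Definition _ := GRing.LRMorphism.on box_eval.

Lemma box_eval_x i : box_eval (box_var_x i) = box_elt (axis i 1) (axis i 0).
Proof. by rewrite /box_eval mpoly_evalX (unsplitK (inl i)). Qed.

Lemma box_eval_y i : box_eval (box_var_y i) = box_elt (axis i 0) (axis i 1).
Proof. by rewrite /box_eval mpoly_evalX (unsplitK (inr i)). Qed.

Lemma box_eval_relation i : box_eval (box_relation i) = 0.
Proof.
rewrite /box_relation rmorphM !rmorphB rmorph1 /= box_eval_x box_eval_y.
by apply: val_inj; exact: box_bracket_relation.
Qed.

(** The image is a subalgebra and contains each generator: the box with corners a and b is the image
    of the product of the x_i^(a_i) y_i^(b_i - a_i). *)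
Lemma box_eval_surj f : exists p, box_eval p = f.
Proof.
case: f => f fM.
suff /asboolP[p pf] : f \in [pred g | `[< exists p, val (box_eval p) = g >]].
  by exists p; exact: val_inj.
have /asboolP := fM; apply=> [|_ [P [a [b [ab Pab]]] <-]].
  split=> [|c g h /asboolP[p <-] /asboolP[q <-]|g h /asboolP[p <-] /asboolP[q <-]].
  - by apply/asboolP; exists 1; rewrite rmorph1.
  - by apply/asboolP; exists (c *: p + q); rewrite linearP.
  - by apply/asboolP; exists (p * q); rewrite rmorphM.
apply/asboolP; exists (\prod_i (box_var_x i ^+ a i * box_var_y i ^+ (b i - a i)%N)).
rewrite rmorph_prod; under eq_bigr do rewrite rmorphM !rmorphXn /= box_eval_x box_eval_y.
rewrite rmorph_prod; under eq_bigr do rewrite rmorphM !rmorphXn /=.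
rewrite box_bracket_monomial; apply: bracket_ext; rewrite Pab /=.
by congr box; apply/funext => i; rewrite subnKC.
Qed.

Lemma box_eval_monomial k :
  val (box_monomial (box_eval \o @box_var_x R d) (box_eval \o @box_var_y R d) k) =
  box_bracket (fun i => (k i).1) (fun i => (k i).2).
Proof.
rewrite /box_monomial rmorph_prod -box_bracket_monomial; apply: eq_bigr => i _.
by rewrite rmorphM !rmorphXn /= box_eval_x box_eval_y.
Qed.

Lemma box_eval_presentation : is_box_presentation box_eval.
Proof.
split=> i.
  rewrite box_eval_x [LHS]bracketE; congr indicator.
  apply/seteqP; split=> x /=.
    move=> xi; apply/rowP => j; apply/eqP; rewrite mxE eqxx /= eq_le andbC.
    by have := xi j; rewrite /axis mul0n addn0 mul1n.
  by move=> -> j; rewrite mxE eqxx /axis mul0n addn0 mul1n lexx.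
rewrite box_eval_y [LHS]bracketE; congr indicator.
apply/seteqP; split=> [x xi|_ [x x01 <-] j] /=.
  exists (const_mx (x 0 i)) => [j|]; first by have := xi i; rewrite mxE /axis eqxx.
  apply/rowP => j; rewrite /coord_proj !mxE eqxx /=; have := xi j; rewrite /axis.
  have [->|ji] := eqVneq j i; first by rewrite mulr1.
  by rewrite mulr0 => x0; apply/esym/eqP; rewrite eq_le andbC.
rewrite /axis /coord_proj !mxE eqxx /=; case: eqVneq => _; last by rewrite mulr0 !muln0 lexx.
by rewrite mulr1; have := x01 i.
Qed.

Definition point_value (z : 'rV[R]_d) (f : M) : C^o := poly_fun_val (subalg_val f) z.

Lemma point_value_linear z : linear (point_value z).
Proof. by move=> c f g; rewrite /point_value /=; reflexivity. Qed.

HB.instance Definition _ z :=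
  GRing.isLinear.Build C M C^o *:%R (point_value z) (point_value_linear z).

(* Evaluating at the centre of the box of k only detects boxes with at least as
   many nondegenerate sides, and k itself among those with equally many. *)
Lemma box_monomial_indep :
  lin_indep (box_monomial (box_eval \o @box_var_x R d) (box_eval \o @box_var_y R d)).
Proof.
pose center (k : {ffun 'I_d -> nat * bool}) : 'rV[R]_d := \row_i ((k i).1%:R + (k i).2%:R / 2).
pose mu (k : {ffun 'I_d -> nat * bool}) := (\sum_i (k i).2)%N.
have evE (j k : {ffun 'I_d -> nat * bool}) :
  point_value (center j)
    (box_monomial (box_eval \o @box_var_x R d) (box_eval \o @box_var_y R d) k) =
  [forall i, (k i).1%:R <= ((j i).1%:R + (j i).2%:R / 2 : R)
                        <= ((k i).1 + (k i).2)%:R]%:R.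
  rewrite /point_value (box_eval_monomial k) box_bracketE.
  by congr (nat_of_bool _)%:R; apply: eq_forallb => i; rewrite mxE.
apply: (@triangular_lin_indep _ _ _ _ mu d (fun j => point_value (center j))) => [k|k|j k kj] /=.
- rewrite -[leqRHS]card_ord -sum1_card; apply: leq_sum => i _; exact: leq_b1.
- rewrite evE; case: forallP => // -[] i.
  by rewrite natrD; case: (k i).2 => /=; lra.
rewrite evE pnatr_eq0 eqb0 negbK => /forallP jk.
(* A half-integer coordinate of the centre of [j] cannot lie in a degenerate side of [k], which is a
   single integer. *)
have jk2 i : ((j i).2 <= (k i).2 ?= iff ((j i).2 == (k i).2))%N.
  split; last by case: (j i).2; case: (k i).2.
  have := jk i; rewrite !natrD; case: (j i).2; case: (k i).2 => //=.
  rewrite addr0 => /andP[k1 k2]; have : ((j i).1%:R < (k i).1%:R :> R) by lra.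
  have : ((k i).1%:R < (j i).1.+1%:R :> R) by rewrite -addn1 natrD; lra.
  by rewrite !ltr_nat ltnS leqNgt => /negbTE->.
have [le eq] := leqif_sum (fun i (_ : true) => jk2 i).
rewrite ltn_neqAle /mu le eq andbT; apply: contra kj => /forallP jkE.
apply/eqP/ffunP => i; have := jk i; have /= /eqP := jkE i.
case: (j i) (k i) => [a s] [b t] /= <-; rewrite natrD => abs.
(* With equal side length s, the centre a + s/2 lies in [b, b + s], so a and b differ by at most
   1/2. *)
suff -> : b = a by [].
apply/eqP; rewrite eqn_leq -[(b <= a)%N]ltnS -[(a <= b)%N]ltnS -!(ltr_nat R).
by rewrite -!natr1; case: s abs => /= ?; apply/andP; split; lra.
Qed.

End BoxBrackets.

(** * The quotient map as an algebra homomorphism, and comparison of generated subalgebras *)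

Section QuotientMap.
Context {K : nzRingType} {A : comAlgType K} (I : idealr A).

Lemma alg_quot_pi_linear : linear (alg_quot_pi I).
Proof.
(* Scalars act on the quotient through the class of [c%:A], hence the inserted factor 1. *)
by move=> c a b; rewrite alg_quot_piD -{1}[a]mul1r scalerAl alg_quot_piM.
Qed.

Lemma alg_quot_pi_monoid_morphism : monoid_morphism (alg_quot_pi I).
Proof. by split; [exact: alg_quot_pi1|exact: alg_quot_piM]. Qed.

HB.instance Definition _ :=
  GRing.isLinear.Build K A (alg_quot I) *:%R (alg_quot_pi I) alg_quot_pi_linear.
HB.instance Definition _ :=
  GRing.isMonoidMorphism.Build A (alg_quot I) (alg_quot_pi I)
    alg_quot_pi_monoid_morphism.

Lemma alg_quot_pi_eq0 a : (alg_quot_pi I a == 0) = (a \in I).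
Proof.
rewrite -[a in RHS]subr0 Quotient.idealrBE.
by rewrite -(linear0 (alg_quot_pi I)).
Qed.

Lemma alg_quot_pi_surj (q : alg_quot I) : exists a, alg_quot_pi I a = q.
Proof. by exists (repr q); rewrite /alg_quot_pi reprK. Qed.

End QuotientMap.

(** Different generating sets give different types even when the subalgebras coincide; this map
    passes between them. *)
Lemma subalg_cast {K : nzRingType} {A : comAlgType K} (S S' : set A) :
  gen_subalg S =i gen_subalg S' ->
  exists f : {lrmorphism subalg S -> subalg S'}, forall x, val (f x) = val x.
Proof.
move=> SS'.
have mem (x : subalg S) : val x \in gen_subalg S' by rewrite -SS'; exact: valP.
pose f x := Subalg (mem x).
have fL : linear f by move=> c x y; apply: val_inj; rewrite !linearP.
have fM : monoid_morphism f.
  by split=> [|x y]; apply: val_inj; rewrite ?rmorph1 ?rmorphM.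
pose fl := GRing.isLinear.Build K (subalg S) (subalg S') *:%R f fL.
pose fm := GRing.isMonoidMorphism.Build (subalg S) (subalg S') f fM.
by exists (HB.pack f fl fm : {lrmorphism subalg S -> subalg S'}).
Qed.

Lemma mem_gen_subalg {K : nzRingType} {A : comAlgType K} (S : set A) x :
  S x -> x \in gen_subalg S.
Proof. by move=> Sx; apply/asboolP => B _; apply. Qed.

Lemma gen_subalg_sub {K : nzRingType} {A : comAlgType K} (S S' : set A) :
  (forall x, S x -> x \in gen_subalg S') -> {subset gen_subalg S <= gen_subalg S'}.
Proof.
move=> SS' x /asboolP xS; apply/asboolP => B Bc S'B; apply: xS => // y /SS'.
by move=> /asboolP; apply.
Qed.

(** * The presentation of the box ring and its tensor decomposition *)

Section Presentation.
Context {R : realType}.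
Local Notation C := (R[i]).

Lemma box_ideal_sub_kernel {d : nat} {B : lalgType C}
    (phi : {lrmorphism {mpoly C[d + d]} -> B}) p :
  (forall i, phi (box_relation i) = 0) -> p \in box_ideal R d -> phi p = 0.
Proof.
move=> rel /asboolP[c ->]; rewrite linear_sum big1// => i _.
by rewrite rmorphM /= rel mulr0.
Qed.

Lemma box_relation_image {d : nat} {B : lalgType C}
    (phi : {lrmorphism {mpoly C[d + d]} -> B}) i :
  phi (box_relation i) =
  (phi (box_var_y i) - 1) * (phi (box_var_y i) - phi (box_var_x i)).
Proof. by rewrite /box_relation rmorphM !rmorphB rmorph1. Qed.

Lemma presented_in_span {d : nat} {B : comAlgType C}
    (phi : {lrmorphism {mpoly C[d + d]} -> B}) :
  (forall i, phi (box_relation i) = 0) -> (forall b, exists p, phi p = b) ->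
  forall b, in_span (box_monomial (phi \o @box_var_x R d) (phi \o @box_var_y R d)) b.
Proof.
move=> rel surj b; have [p <-] := surj b; apply: mpoly_in_span => i.
by rewrite -(rel i) box_relation_image.
Qed.

(** [box_eval] kills the relations and so factors through the quotient. The factor is injective
    because the box monomials span the quotient while their images are independent. *)
Lemma box_algebra_iso d :
  exists2 psi : {lrmorphism box_algebra R d -> minkowski_ring (boxes R d)},
    (forall p, psi (alg_quot_pi (box_ideal R d) p) = box_eval p) & bijective psi.
Proof.
pose pi := alg_quot_pi (box_ideal R d).
have pi_rel i : pi (box_relation i) = 0.
  apply/eqP; rewrite alg_quot_pi_eq0; apply/asboolP.
  exists (fun j => (j == i)%:R); rewrite (bigD1 i)//= eqxx mul1r big1 ?addr0// => j ji.
  by rewrite (negbTE ji) mul0r.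
have [|psi psiE] := @lrmorphism_factor _ _ _ _ pi box_eval (@alg_quot_pi_surj _ _ _).
  move=> p /eqP; rewrite alg_quot_pi_eq0.
  exact: box_ideal_sub_kernel box_eval_relation.
exists psi => //.
have psi0 q : psi q = 0 -> q = 0.
  have [s ->] := presented_in_span pi_rel (@alg_quot_pi_surj _ _ _) q.
  rewrite lincomb_map => s0; apply: lin_indep_eq0 (@box_monomial_indep R d) _.
  rewrite -[RHS]s0; apply: eq_bigr => p _; congr (_ *: _).
  rewrite [RHS]rmorph_box_monomial /box_monomial; apply: eq_bigr => i _ /=.
  by rewrite !psiE.
have inj : injective psi.
  by move=> a b ab; apply/subr0_eq/psi0; rewrite linearB /= ab subrr.
have surj f : exists q, psi q = f.
  by have [p <-] := box_eval_surj f; exists (pi p); rewrite psiE.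
have [r rK] := choice surj; exists r => // q.
by apply: inj; rewrite rK.
Qed.

Lemma box_eval_kernel d p :
  (box_eval p == 0 :> minkowski_ring (boxes R d)) = (p \in box_ideal R d).
Proof.
have [psi psiE psi_bij] := box_algebra_iso d.
by rewrite -psiE -(linear0 psi) (bij_eq psi_bij) alg_quot_pi_eq0.
Qed.

(** [B] is any algebra with the one-dimensional presentation, which covers both forms of the tensor
    factor. The tensor map is the product of homomorphisms [iota i] placing [B] on the i-th axis. *)
Lemma box_tensor {d : nat} {B T : comAlgType C}
    (phi1 : {lrmorphism {mpoly C[1 + 1]} -> B})
    (phi : {lrmorphism {mpoly C[d + d]} -> T}) :
  (forall b, exists p, phi1 p = b) ->
  (forall p, (phi1 p == 0) = (p \in box_ideal R 1)) ->
  (forall b, exists p, phi p = b) -> (forall i, phi (box_relation i) = 0) ->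
  lin_indep (box_monomial (phi \o @box_var_x R d) (phi \o @box_var_y R d)) ->
  exists t : ('I_d -> B) -> T, is_tensor_product (fun=> B) t.
Proof.
move=> surj1 ker1 surj rel indep.
pose coord_map (i : 'I_d) : {mpoly C[1 + 1]} -> {mpoly C[d + d]} :=
  mpoly_eval (fun j : 'I_(1 + 1) => match fintype.split j with
                                    | inl _ => box_var_x i
                                    | inr _ => box_var_y i
                                    end).
have coord_x i j : coord_map i (box_var_x j) = box_var_x i.
  by rewrite /coord_map mpoly_evalX (unsplitK (inl j)).
have coord_y i j : coord_map i (box_var_y j) = box_var_y i.
  by rewrite /coord_map mpoly_evalX (unsplitK (inr j)).
(* Substituting x_i and y_i turns the one-dimensional relation into the i-th relation, which [phi]
   kills. *)
have /choice[iota iotaE] (i : 'I_d) : exists iota : {lrmorphism B -> T},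
    forall p, iota (phi1 p) = phi (coord_map i p).
  apply: (@lrmorphism_factor _ _ _ _ phi1 (phi \o mpoly_eval _)) => // p /eqP.
  rewrite ker1; apply: box_ideal_sub_kernel => j.
  rewrite box_relation_image /= -!/(coord_map i _) coord_x coord_y.
  by rewrite -(box_relation_image phi) rel.
pose t (a : 'I_d -> B) : T := \prod_i iota i (a i).
have t_linear : @multilinear C 'I_d (fun=> B) T t.
  move=> a i c u v.
  have tE w : t (dfwith (T := fun=> B) a (i := i) w) =
      iota i w * \prod_(j | j != i) iota j (a j).
    rewrite /t (bigD1 i)//= dfwith_in; congr (_ * _).
    by apply: eq_bigr => j ji; rewrite dfwith_out// eq_sym.
  by rewrite !tE linearP mulrDl scalerAl.
pose E1 := box_monomial (phi1 \o @box_var_x R 1) (phi1 \o @box_var_y R 1).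
pose E := box_monomial (phi \o @box_var_x R d) (phi \o @box_var_y R d).
have span1 : forall b, in_span E1 b.
  apply: (presented_in_span _ surj1) => i; apply/eqP; rewrite ker1; apply/asboolP.
  by exists (fun=> 1); rewrite big_ord1 mul1r (ord1 i).
have span : forall b, in_span E b by exact: presented_in_span.
have tE1 (k : 'I_d -> {ffun 'I_1 -> nat * bool}) :
    t (E1 \o k) = E [ffun i => k i 0].
  rewrite /t /E /box_monomial; apply: eq_bigr => i _.
  by rewrite rmorph_box_monomial /box_monomial big_ord1 /= !iotaE coord_x coord_y ffunE.
have cst_ffun (k : {ffun 'I_1 -> nat * bool}) : [ffun=> k 0] = k.
  by apply/ffunP => i; rewrite ffunE (ord1 i).
exists t; split=> // [V f fL||a b].
- pose tuple_of (j : {ffun 'I_d -> nat * bool}) (i : 'I_d) : {ffun 'I_1 -> nat * bool} :=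
    [ffun=> j i].
  (* Every basis element of [T] is a pure tensor. This prescribes [g] on the basis and yields its
     uniqueness. *)
  have E_t j : E j = t (E1 \o tuple_of j).
    by rewrite tE1; congr E; apply/ffunP => i; rewrite !ffunE.
  have [g gE] := lin_indep_extend (fun j => f (E1 \o tuple_of j)) span indep.
  exists g; split=> [|h hE b].
    (* Both [g] after [t] and [f] are multilinear, so tuples of spanning monomials suffice. *)
    apply: (multilinear_ext span1) => [a i c u v|//|k] /=.
      by rewrite t_linear linearP.
    rewrite tE1 gE; congr f; apply/funext => i /=; congr E1.
    by rewrite /tuple_of ffunE cst_ffun.
  have [s ->] := span b; rewrite !lincomb_map; apply: eq_bigr => p _ /=.
  by rewrite gE E_t hE.
- by rewrite /t big1// => i _; rewrite rmorph1.
- by rewrite /t -big_split; apply: eq_bigr => i _; rewrite rmorphM.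
Qed.

(** The interval [a, b] is the product of the a-th power of {1} and the (b - a)-th power of [0,1];
    conversely, both generators are boxes. *)
Lemma box1_subalg :
  minkowski_subalg (boxes R 1) =i minkowski_subalg (point_and_segment R).
Proof.
have axis01 m (j : 'I_1) : axis ord0 m j = m by rewrite /axis (ord1 j) muln1.
have pt : @box R 1 (axis ord0 1) (fun j => axis ord0 1 j + axis ord0 0 j)%N = [set const_mx 1].
  apply/seteqP; split=> x /= => [x1|->] => [|j].
    apply/rowP => j; apply/eqP; rewrite mxE eq_le andbC.
    by have := x1 j; rewrite !axis01 addn0.
  by rewrite mxE !axis01 addn0 lexx.
have seg : @box R 1 (axis ord0 0) (fun j => axis ord0 0 j + axis ord0 1 j)%N = unit_cube R 1.
  by congr box; apply/funext => j; rewrite !axis01.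
move=> f; apply/idP/idP; apply: gen_subalg_sub => _ [P PS <-].
  have [a [b [ab Pab]]] := PS.
  have -> : bracket P = box_bracket a (fun i => b i - a i)%N.
    apply: bracket_ext; rewrite Pab /=; congr box; apply/funext => i.
    by rewrite subnKC.
  rewrite -box_bracket_monomial big_ord1; apply: rpredM; apply: rpredX.
    apply: mem_gen_subalg; exists (box_polyhedron (axis ord0 1) (axis ord0 0)) => //.
    by left.
  apply: mem_gen_subalg; exists (box_polyhedron (axis ord0 0) (axis ord0 1)) => //.
  by right.
apply: mem_gen_subalg; exists P => //; case: PS => PE.
  exists (axis ord0 1), (fun j => axis ord0 1 j + axis ord0 0 j)%N; rewrite pt -PE.
  by split=> // i; rewrite leq_addr.
exists (axis ord0 0), (fun j => axis ord0 0 j + axis ord0 1 j)%N; rewrite seg -PE.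
by split=> // i; rewrite leq_addr.
Qed.

End Presentation.

Theorem corollary3p12 (R : realType) (d : nat) (d_ge1 : (1 <= d)%N) :
  [/\ exists phi : {lrmorphism {mpoly R[i][d + d]} -> minkowski_ring (boxes R d)},
        [/\ is_box_presentation phi,
            forall psi : {lrmorphism {mpoly R[i][d + d]} -> minkowski_ring (boxes R d)},
              is_box_presentation psi -> psi =1 phi,
            forall f, exists p, phi p = f &
            forall p, (phi p == 0) = (p \in box_ideal R d)],
      exists psi : {lrmorphism box_algebra R d -> minkowski_ring (boxes R d)},
        bijective psi,
      exists t : ('I_d -> minkowski_ring (boxes R 1)) -> minkowski_ring (boxes R d),
        is_tensor_product (fun=> minkowski_ring (boxes R 1)) t,
      minkowski_subalg (boxes R 1) =i minkowski_subalg (point_and_segment R) &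
      exists t : ('I_d -> minkowski_ring (point_and_segment R)) ->
          minkowski_ring (boxes R d),
        is_tensor_product (fun=> minkowski_ring (point_and_segment R)) t].
Proof.
split.
- exists box_eval; split.
  + exact: box_eval_presentation.
  + move=> psi [psix psiy]; have [phix phiy] := @box_eval_presentation R d.
    (* A presentation prescribes the images of the variables as functions, two subtypes below the
       ring. *)
    apply: mpoly_lrmorphism_ext => j; do 2 apply: val_inj.
    by case: (split_ordP j) => i ->; [exact: etrans (psix i) (esym (phix i))
                                     |exact: etrans (psiy i) (esym (phiy i))].
  + exact: box_eval_surj.
  + exact: box_eval_kernel.
- by have [psi _ psi_bij] := @box_algebra_iso R d; exists psi.
- exact: box_tensor (@box_eval_surj R 1) (@box_eval_kernel R 1)
    (@box_eval_surj R d) (@box_eval_relation R d) (@box_monomial_indep R d).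
- exact: box1_subalg.
(* Composing [box_eval] with [f] presents the ring generated by {1} and [0,1] with the same
   kernel. *)
have [f fE] := subalg_cast (@box1_subalg R).
have f_eq0 m : (f m == 0) = (m == 0).
  by rewrite -!val_eqE fE.
apply: (box_tensor (phi1 := f \o box_eval)) (@box_eval_surj R d)
  (@box_eval_relation R d) (@box_monomial_indep R d) => [b|p]; last first.
  by rewrite /= f_eq0 box_eval_kernel.
have bM : val b \in minkowski_subalg (boxes R 1) by rewrite box1_subalg; exact: valP.
have [p pb] := box_eval_surj (Subalg bM).
by exists p; apply: val_inj; rewrite /= fE pb.
Qed.
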